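(* Let $V=\{v_1,\dots,v_m\}\subset\mathbb{R}^d$ be a finite set of $m$ points and let $r\in\mathrm{relint}(\mathrm{conv}(V))$. Let $k=\dim(\mathrm{aff}(V))$. Let $\mathcal{K}(V,r)=\{S\subset V\mid r\notin\mathrm{conv}(S)\}$ be the $r$-unbalanced simplicial complex on vertex set $V$, and let $\mathcal{K}^*(V,r)=\{\sigma\subset V\mid V\setminus\sigma\notin\mathcal{K}(V,r)\}$ be its Alexander dual. Then \[ \mathcal{K}(V,r)\simeq S^{k-1}\quad\text{and}\quad\mathcal{K}^*(V,r)\simeq S^{m-k-2}. \]
   Context: $\mathrm{aff}(V)$ is the affine hull of $V$ and $\mathrm{relint}$ denotes relative interior. $\simeq$ denotes homotopy equivalence (of geometric realizations). *)

(* Defs.v *)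
From HB Require Import structures.
From mathcomp Require Import all_boot all_order all_algebra.
From mathcomp Require Import all_classical all_reals all_analysis.
Set Implicit Arguments. Unset Strict Implicit. Unset Printing Implicit Defensive.
Import Order.TTheory GRing.Theory Num.Theory.
Import numFieldNormedType.Exports.
Local Open Scope classical_set_scope.
Local Open Scope ring_scope.

Section Defs.
Variables (R : realType) (d m : nat).

Definition conv_sub (v : 'I_m -> 'rV[R]_d) (S : {set 'I_m}) : set 'rV[R]_d :=
  [set p | exists w : 'I_m -> R,
     (forall i, 0 <= w i) /\ (forall i, i \notin S -> w i = 0) /\
     \sum_(i < m) w i = 1 /\ p = \sum_(i < m) w i *: v i].

Definition aff_hull (v : 'I_m -> 'rV[R]_d) : set 'rV[R]_d :=
  [set p | exists w : 'I_m -> R,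
     \sum_(i < m) w i = 1 /\ p = \sum_(i < m) w i *: v i].

(* dimension of the affine hull = dimension of its direction space,
   spanned by the differences v i - v j *)
Definition aff_dim (v : 'I_m -> 'rV[R]_d) : nat :=
  \rank (\sum_(i < m) \sum_(j < m) <<v i - v j>>)%MS.

(* relative interior of A, taken relative to the affine set E (= aff A) *)
Definition relint_in (E A : set 'rV[R]_d) : set 'rV[R]_d :=
  [set x | A x /\ exists e : R, 0 < e /\
     forall y, E y -> `|y - x| < e -> A y].

Definition unbalanced (v : 'I_m -> 'rV[R]_d) (r : 'rV[R]_d) : {set {set 'I_m}} :=
  [set S : {set 'I_m} | `[< ~ conv_sub v S r >]].

Definition alex_dual (K : {set {set 'I_m}}) : {set {set 'I_m}} :=
  [set s : {set 'I_m} | ~: s \notin K].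

(* geometric realization of a simplicial complex on vertex set 'I_m,
   inside the standard simplex of R^m (barycentric coordinates) *)
Definition realization (K : {set {set 'I_m}}) : set 'rV[R]_m :=
  [set x | exists2 S, S \in K &
     (forall i, 0 <= x ord0 i) /\ (forall i, i \notin S -> x ord0 i = 0) /\
     \sum_(i < m) x ord0 i = 1].
End Defs.

(* unit sphere S^(n-1) in R^n *)
Definition sphere (R : realType) (n : nat) : set 'rV[R]_n :=
  [set x | \sum_(i < n) x ord0 i ^+ 2 = 1].

Definition homotopic_in (R : realType) (T U : topologicalType) (A : set T)
  (B : set U) (f g : T -> U) : Prop :=
  exists H : T * R -> U,
    {within A `*` `[0, 1]%classic, continuous H} /\
    H @` (A `*` `[0, 1]%classic) `<=` B /\
    forall x, A x -> H (x, 0) = f x /\ H (x, 1) = g x.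

Definition homotopy_equiv (R : realType) (T U : topologicalType)
  (A : set T) (B : set U) : Prop :=
  exists (f : T -> U) (g : U -> T),
    {within A, continuous f} /\ f @` A `<=` B /\
    {within B, continuous g} /\ g @` B `<=` A /\
    homotopic_in R A A (g \o f) id /\ homotopic_in R B B (f \o g) id.
Arguments homotopy_equiv R {T U} A B.
Arguments homotopic_in R {T U} A B f g.
Arguments sphere R n : clear implicits.
Arguments realization R {m} K.

(* Main.v *)
(* Both complexes are nerves of a cover of R^n minus the origin by open convex
   cones C_i = {rho_i > 0}, and such a nerve is homotopy equivalent to S^(n-1).

   For K(V,r), C_i is the open half-space of functionals u on the direction space
   of aff(V) with u(v_i - r) > 0: by Gordan's theorem the cones over S have a
   common point iff r is not in conv(S), and they cover because r is a convex
   combination of V with strictly positive weights w.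

   For the dual, let P be the polytope of all convex weights representing r, so
   that s is in K* iff P has a point vanishing on s.  Directions l of P run through
   a space of dimension m-k-1, and C_i = {l | l_i/w_i > (1-e) l_j/w_j for all j}
   is an open thickening of the cone over the i-th facet of P as seen from w; for e
   small enough the thickening creates no new intersections. *)
Require Import Defs.
From HB Require Import structures.
From mathcomp Require Import all_boot all_order all_algebra.
From mathcomp Require Import all_classical all_reals all_analysis.
From mathcomp Require Import ring lra.
Import Order.TTheory GRing.Theory Num.Theory.
Import numFieldNormedType.Exports.
Local Open Scope classical_set_scope.
Local Open Scope ring_scope.
Set Implicit Arguments. Unset Strict Implicit. Unset Printing Implicit Defensive.

(** Continuity is followed at one point at a time: the normalised maps below are continuous only
    where their denominators are nonzero, and continuity at each point of [A] yields
    [{within A, continuous f}]. *)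
Definition cts_at {T U : topologicalType} (x : T) (f : T -> U) : Prop := f @ x --> f x.

(** * Rules for continuity at a point *)

Section PointwiseContinuity.
Context {R : realType} {T : topologicalType} (x : T).

Lemma cts_at_eq {U : topologicalType} (f g : T -> U) : f =1 g -> cts_at x f -> cts_at x g.
Proof. by move=> /funext ->. Qed.

Lemma cont_cst {U : topologicalType} (c : U) : cts_at x (fun _ : T => c).
Proof. exact: cst_continuous. Qed.

Lemma cont_add (f g : T -> R) : cts_at x f -> cts_at x g ->
  cts_at x (fun y => f y + g y).
Proof. by move=> cf cg; apply: (@continuousD _ R^o). Qed.

Lemma cont_sub (f g : T -> R) : cts_at x f -> cts_at x g ->
  cts_at x (fun y => f y - g y).
Proof. by move=> cf cg; apply: (@continuousB _ R^o). Qed.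

Lemma cont_mul (f g : T -> R) : cts_at x f -> cts_at x g ->
  cts_at x (fun y => f y * g y).
Proof. by move=> cf cg; apply: continuousM. Qed.

Lemma cont_inv (f : T -> R) : f x != 0 -> cts_at x f ->
  cts_at x (fun y => (f y)^-1).
Proof. by move=> fx cf; apply: continuousV. Qed.

Lemma cont_pos (f : T -> R) : cts_at x f ->
  cts_at x (fun y => Num.max 0 (f y)).
Proof. by move=> cf; apply: (@continuous_max R T (fun=> 0) f) => //; exact: cont_cst. Qed.

Lemma cont_sqrt (f : T -> R) : cts_at x f ->
  cts_at x (fun y => Num.sqrt (f y)).
Proof. by move=> cf; apply: continuous_comp => //; exact: sqrt_continuous. Qed.

Lemma cont_sum (I : Type) (s : seq I) (P : pred I) (F : I -> T -> R) :
  (forall i, cts_at x (F i)) ->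
  cts_at x (fun y => \sum_(i <- s | P i) F i y).
Proof.
move=> cF; elim: s => [|i s IH].
  under eq_fun do rewrite big_nil; exact: cont_cst.
under eq_fun do rewrite big_cons.
by case: (P i) => //; apply: cont_add.
Qed.

Lemma cont_prod (I : Type) (s : seq I) (P : pred I) (F : I -> T -> R) :
  (forall i, cts_at x (F i)) ->
  cts_at x (fun y => \prod_(i <- s | P i) F i y).
Proof.
move=> cF; elim: s => [|i s IH].
  under eq_fun do rewrite big_nil; exact: cont_cst.
under eq_fun do rewrite big_cons.
by case: (P i) => //; apply: cont_mul.
Qed.

Lemma cont_coord n (f : T -> 'rV[R]_n) i : cts_at x f ->
  cts_at x (fun y => f y ord0 i).
Proof.
by move=> cf; apply: (@continuous_comp _ _ _ f (fun A => A ord0 i)) => //; exact: coord_continuous.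
Qed.

Lemma cont_row n (f : T -> 'rV[R]_n) :
  (forall i, cts_at x (fun y => f y ord0 i)) -> cts_at x f.
Proof.
move=> cf A [P Pf sPA].
have : \forall y \near x, forall i, P ord0 i (f y ord0 i).
  by apply: filter_forall => i; apply: (cf i); exact: Pf.
by apply: filterS => y Py; apply: sPA => i j; rewrite ord1; exact: Py.
Qed.

End PointwiseContinuity.

(** * Normalisation onto simplices and unit spheres *)

Section Projections.
Context {R : realType}.

Definition simplex_proj {m} (x : 'rV[R]_m) : 'rV[R]_m := (\sum_i x ord0 i)^-1 *: x.

Definition sphere_proj {n} (x : 'rV[R]_n) : 'rV[R]_n :=
  (Num.sqrt (\sum_i x ord0 i ^+ 2))^-1 *: x.

(** The body repeats the condition in [realization], so a point of [realization R K] unfolds to a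
    point of [face S] for some [S] in [K]. *)
Definition face {m} (S : {set 'I_m}) : set 'rV[R]_m :=
  [set x | (forall i, 0 <= x ord0 i) /\ (forall i, i \notin S -> x ord0 i = 0) /\
           \sum_i x ord0 i = 1].

Lemma sum_pos m (F : 'I_m -> R) i : (forall j, 0 <= F j) -> 0 < F i -> 0 < \sum_j F j.
Proof.
move=> F0 Fi; rewrite (bigD1 i) //=; apply: ltr_pwDl => //.
by apply: sumr_ge0.
Qed.

Lemma face_simplex_proj m (S : {set 'I_m}) (x : 'rV[R]_m) i :
  (forall j, 0 <= x ord0 j) -> 0 < x ord0 i ->
  (forall j, 0 < x ord0 j -> j \in S) -> face S (simplex_proj x).
Proof.
move=> x0 xi xS; have s0 := sum_pos x0 xi; split; [|split] => [j|j jS|].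
- by rewrite mxE mulr_ge0 // invr_ge0 ltW.
- rewrite mxE; have [->|xj] := eqVneq (x ord0 j) 0; first by rewrite mulr0.
  by move: jS; rewrite xS // lt_neqAle eq_sym xj x0.
- under eq_bigr do rewrite mxE.
  by rewrite -mulr_sumr mulVf // gt_eqF.
Qed.

Lemma face_convex m (S : {set 'I_m}) (x y : 'rV[R]_m) a :
  0 <= a <= 1 -> face S x -> face S y -> face S ((1 - a) *: x + a *: y).
Proof.
move=> /andP[a0 a1] [x0 [xS x1]] [y0 [yS y1]]; split; [|split] => [i|i iS|].
- by rewrite !mxE addr_ge0 // mulr_ge0 // subr_ge0.
- by rewrite !mxE xS // yS // !mulr0 addr0.
- under eq_bigr do rewrite !mxE.
  by rewrite big_split /= -!mulr_sumr x1 y1 !mulr1 subrK.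
Qed.

Lemma sqnorm_gt0 n (x : 'rV[R]_n) : x != 0 -> 0 < \sum_i x ord0 i ^+ 2.
Proof.
move=> /eqP x0; have /existsNP [i xi] : ~ forall i, x ord0 i = 0.
  by move=> h; apply: x0; apply/rowP => i; rewrite h mxE.
apply: (@sum_pos _ _ i) => [j|]; first exact: sqr_ge0.
by rewrite lt_neqAle sqr_ge0 andbT eq_sym sqrf_eq0; apply/eqP.
Qed.

Lemma sphere_sphere_proj n (x : 'rV[R]_n) : x != 0 -> sphere R n (sphere_proj x).
Proof.
move=> x0; have s0 := sqnorm_gt0 x0; rewrite /sphere /=.
under eq_bigr do rewrite mxE exprMn.
by rewrite -mulr_sumr exprVn sqr_sqrtr ?ltW // mulVf // gt_eqF.
Qed.

Lemma sphere_proj_id n (x : 'rV[R]_n) : sphere R n x -> sphere_proj x = x.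
Proof. by rewrite /sphere /sphere_proj /= => ->; rewrite sqrtr1 invr1 scale1r. Qed.

Lemma sphere_neq0 n (x : 'rV[R]_n) : sphere R n x -> x != 0.
Proof.
rewrite /sphere /=; apply: contra_eq_neq => ->.
rewrite big1 => [|i _]; last by rewrite mxE expr0n.
by rewrite eq_sym oner_eq0.
Qed.

Lemma cont_simplex_proj (T : topologicalType) (x : T) m (f : T -> 'rV[R]_m) :
  \sum_i f x ord0 i != 0 -> (forall i, cts_at x (fun y => f y ord0 i)) ->
  cts_at x (fun y => simplex_proj (f y)).
Proof.
move=> f0 cf; apply: cont_row => i; apply: cts_at_eq => [y|]; first by rewrite mxE.
by apply: cont_mul => //; apply: cont_inv => //; exact: cont_sum.
Qed.

Lemma cont_sphere_proj (T : topologicalType) (x : T) n (f : T -> 'rV[R]_n) :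
  f x != 0 -> (forall i, cts_at x (fun y => f y ord0 i)) ->
  cts_at x (fun y => sphere_proj (f y)).
Proof.
move=> f0 cf; apply: cont_row => i; apply: cts_at_eq => [y|]; first by rewrite mxE.
apply: cont_mul => //; apply: cont_inv; first by rewrite gt_eqF // sqrtr_gt0 sqnorm_gt0.
apply: cont_sqrt; apply: cont_sum => j; apply: cts_at_eq => [y|]; first by rewrite expr2.
exact: cont_mul.
Qed.

End Projections.

(** Coordinates all at most 1/(m+1) sum to at most m/(m+1) < 1. With 1/m as threshold the strict
    inequality would fail at the barycentre. *)
Lemma face_large_coord (R : realType) m (S : {set 'I_m}) (x : 'rV[R]_m) :
  face S x -> exists i, m.+1%:R^-1 < x ord0 i.
Proof.
move=> [_ [_ x1]]; apply: contrapT => /forallNP xle.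
have : \sum_i x ord0 i <= \sum_(i < m) m.+1%:R^-1.
  by apply: ler_sum => i _; rewrite leNgt; apply/negP.
rewrite x1 sumr_const card_ord -[X in _ <= X]mulr_natl ler_pdivlMr ?ltr0Sn // mul1r.
by rewrite ler_nat ltnn.
Qed.

(** * The nerve of a cover by open convex cones *)

Section ConeNerve.
Context {R : realType} {m n : nat} (K : {set {set 'I_m}}) (rho : 'I_m -> 'rV[R]_n -> R).
Hypothesis rho_cont : forall i, continuous (rho i).
Hypothesis rho_ge0 : forall i u, 0 <= rho i u.
Hypothesis rho0 : forall i, rho i 0 = 0.
Hypothesis rhoD : forall i u v, 0 < rho i u -> 0 < rho i v -> 0 < rho i (u + v).
Hypothesis rhoZ : forall i a u, 0 < a -> 0 < rho i u -> 0 < rho i (a *: u).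
Hypothesis rho_cover : forall u, u != 0 -> exists i, 0 < rho i u.
Hypothesis nerve_sub : forall (S : {set 'I_m}) u, (forall i, i \in S -> 0 < rho i u) -> S \in K.
(** A choice of a common point of the cones {rho_i > 0} over each simplex; together with [nerve_sub]
    it says that [K] is the nerve of these cones. *)
Variable pt : {set 'I_m} -> 'rV[R]_n.
Hypothesis pt_nerve : forall S i, S \in K -> i \in S -> 0 < rho i (pt S).

Local Notation eps := (m.+1%:R^-1 : R).
Local Notation pos := (Num.max 0).

(** The origin lies in no cone, so vanishing summands need separate care: a partial sum is zero or
    in the cone, and the summand at [j] then puts the total in the cone. *)
Lemma rho_sum (I : finType) (P : pred I) (F : I -> 'rV[R]_n) i j : P j -> 0 < rho i (F j) ->
  (forall k, P k -> F k = 0 \/ 0 < rho i (F k)) -> 0 < rho i (\sum_(k | P k) F k).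
Proof.
move=> Pj Fj PF; rewrite (bigD1 j) //=.
have [->|] : \sum_(k | P k && (k != j)) F k = 0 \/ 0 < rho i (\sum_(k | P k && (k != j)) F k).
- elim/big_ind : _ => [|u v [->|u0] [->|v0]|k /andP[/PF //]]; first by left.
  + by left; rewrite addr0.
  + by right; rewrite add0r.
  + by right; rewrite addr0.
  + by right; apply: rhoD.
- by rewrite addr0.
- exact: rhoD.
Qed.

Lemma pos_gt0 (a : R) : (0 < pos a) = (0 < a).
Proof. by rewrite lt_max ltxx. Qed.

Lemma pos_ge0 (a : R) : 0 <= pos a.
Proof. by rewrite le_max lexx. Qed.

Lemma pos_id (a : R) : 0 <= a -> pos a = a.
Proof. by move=> ?; apply/max_idPr. Qed.

Lemma pos_eq0 (a : R) : a <= 0 -> pos a = 0.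
Proof. by move=> ?; apply/max_idPl. Qed.

(* A point [x] has a coordinate above [eps]; a summand survives only when [S] contains
   every [i] with [eps <= x_i], so that the sum lies in all the corresponding cones.
   Requiring this on the whole support of [x] would destroy continuity. *)
Definition to_cone (x : 'rV[R]_m) : 'rV[R]_n :=
  \sum_(S in K) (\prod_(i in ~: S) pos (eps - x ord0 i)) *: pt S.

Definition to_sphere (x : 'rV[R]_m) := sphere_proj (to_cone x).

(** The usual map into a nerve, given by the partition of unity obtained from the [rho i]. *)
Definition bary (u : 'rV[R]_n) : 'rV[R]_m := simplex_proj (\row_i rho i u).

(** Cuts the support of [x] down to the coordinates above [eps], for which [to_cone x] is known to
    lie in the matching cone. *)
Definition shave (x : 'rV[R]_m) : 'rV[R]_m := simplex_proj (\row_i pos (x ord0 i - eps)).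

(** A summand [T] without [i] has the factor [pos (eps - x ord0 i)], which is zero; the others are
    nonnegative multiples of points of the i-th cone. The carrier [S] of [x] contributes a positive
    multiple, since [x] vanishes off [S]. *)
Lemma to_cone_rho x i : realization R K x -> eps <= x ord0 i -> 0 < rho i (to_cone x).
Proof.
move=> [S SK [x0 [xS x1]]] xi.
have e0 : 0 < eps by rewrite invr_gt0 ltr0Sn.
have mem (T : {set 'I_m}) : i \notin T -> \prod_(j in ~: T) pos (eps - x ord0 j) = 0.
  move=> iT; rewrite (bigD1 i) ?inE //= pos_eq0 ?mul0r //.
  by rewrite subr_le0.
have iS : i \in S by apply: contraLR xi => iS; rewrite xS // -ltNge.
apply: (@rho_sum _ (fun T => T \in K) _ i S) => // [|T TK].
- apply: rhoZ; last exact: pt_nerve.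
  by apply: prodr_gt0 => j; rewrite inE => jS; rewrite pos_gt0 xS // subr0.
- have [iT|iT] := boolP (i \in T); last by left; rewrite mem ?scale0r.
  have : 0 <= \prod_(j in ~: T) pos (eps - x ord0 j) by apply: prodr_ge0 => j _; exact: pos_ge0.
  rewrite le_eqVlt => /orP[/eqP<-|p0]; first by left; rewrite scale0r.
  by right; apply: rhoZ => //; exact: pt_nerve.
Qed.

Lemma rho_neq0 i u : 0 < rho i u -> u != 0.
Proof. by apply: contraTneq => ->; rewrite rho0 ltxx. Qed.

Lemma to_cone_neq0 x : realization R K x -> to_cone x != 0.
Proof.
move=> Kx; have [S SK xS] := Kx; have [i xi] := face_large_coord xS.
by apply: (@rho_neq0 i); apply: to_cone_rho => //; exact: ltW.
Qed.

Lemma sphere_proj_rho i u : 0 < rho i u -> 0 < rho i (sphere_proj u).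
Proof.
move=> ui; apply: rhoZ => //; rewrite invr_gt0 sqrtr_gt0.
exact/sqnorm_gt0/rho_neq0/ui.
Qed.

Lemma to_sphere_rho x i : realization R K x -> eps <= x ord0 i -> 0 < rho i (to_sphere x).
Proof. by move=> Kx xi; apply: sphere_proj_rho; exact: to_cone_rho. Qed.

Definition star (u : 'rV[R]_n) : {set 'I_m} := [set i | 0 < rho i u].

Lemma starK u : star u \in K.
Proof. by apply: (nerve_sub (u := u)) => i; rewrite inE. Qed.

Lemma face_bary u : u != 0 -> face (star u) (bary u).
Proof.
move=> /rho_cover [i ui]; apply: (@face_simplex_proj _ _ _ _ i) => [j||j].
- by rewrite mxE.
- by rewrite mxE.
- by rewrite mxE inE.
Qed.

Lemma face_shave (S T : {set 'I_m}) (x : 'rV[R]_m) : face S x -> (forall i, eps < x ord0 i -> i \in T) -> face T (shave x).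
Proof.
move=> xS xT; have [i xi] := face_large_coord xS.
apply: (@face_simplex_proj _ _ _ _ i) => [j||j]; rewrite mxE ?pos_ge0 ?pos_gt0 ?subr_gt0 //.
exact: xT.
Qed.

Lemma bary_gt0 u i : u != 0 -> 0 < bary u ord0 i -> 0 < rho i u.
Proof.
move=> u0; have [_ [b0 _]] := face_bary u0; have [//|ui] := boolP (0 < rho i u).
by rewrite b0 ?inE // ltxx.
Qed.

Lemma to_cone_cont (T : topologicalType) (y : T) (f : T -> 'rV[R]_m) i :
  (forall i, cts_at y (fun z => f z ord0 i)) -> cts_at y (fun z => to_cone (f z) ord0 i).
Proof.
move=> cf; apply: cts_at_eq => [z|]; first by rewrite /to_cone summxE.
apply: cont_sum => S; apply: cts_at_eq => [z|]; first by rewrite mxE.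
apply: cont_mul; last exact: cont_cst.
by apply: cont_prod => j; apply: cont_pos; apply: cont_sub => //; exact: cont_cst.
Qed.

Lemma to_sphere_cont (T : topologicalType) (y : T) (f : T -> 'rV[R]_m) :
  realization R K (f y) ->
  (forall i, cts_at y (fun z => f z ord0 i)) -> cts_at y (fun z => to_sphere (f z)).
Proof.
move=> Kfy cf; apply: cont_sphere_proj => [|i]; first exact: to_cone_neq0.
exact: to_cone_cont.
Qed.

Lemma bary_cont (T : topologicalType) (y : T) (f : T -> 'rV[R]_n) :
  f y != 0 -> cts_at y f -> cts_at y (fun z => bary (f z)).
Proof.
move=> f0 cf; apply: cont_simplex_proj => [|i].
  have [i ui] := rho_cover f0; rewrite gt_eqF //.
  by apply: (@sum_pos _ _ _ i) => [j|]; rewrite mxE.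
apply: cts_at_eq => [z|]; first by rewrite mxE.
by apply: (continuous_comp cf); exact: rho_cont.
Qed.

Lemma shave_cont (T : topologicalType) (y : T) (f : T -> 'rV[R]_m) :
  realization R K (f y) ->
  (forall i, cts_at y (fun z => f z ord0 i)) -> cts_at y (fun z => shave (f z)).
Proof.
move=> [S _ fS] cf; apply: cont_simplex_proj => [|i].
  have [i xi] := face_large_coord fS; rewrite gt_eqF //.
  by apply: (@sum_pos _ _ _ i) => [j|]; rewrite mxE ?pos_ge0 // pos_gt0 subr_gt0.
apply: cts_at_eq => [z|]; first by rewrite mxE.
by apply: cont_pos; apply: cont_sub => //; exact: cont_cst.
Qed.

Lemma realization_bary u : u != 0 -> realization R K (bary u).
Proof. by move=> u0; exists (star u); [exact: starK | exact: face_bary]. Qed.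

Lemma sphere_to_sphere x : realization R K x -> sphere R n (to_sphere x).
Proof. by move=> /to_cone_neq0; exact: sphere_sphere_proj. Qed.

Lemma scal_cont (T : topologicalType) (y : T) k (a : T -> R) (f : T -> 'rV[R]_k) i :
  cts_at y a -> cts_at y f -> cts_at y (fun z => (a z *: f z) ord0 i).
Proof.
move=> ca cf; apply: cts_at_eq => [z|]; first by rewrite mxE.
by apply: cont_mul => //; exact: cont_coord.
Qed.

(* [x] and [bary (to_sphere x)] need not lie in a common simplex, but [shave x] lies both in
   the carrier of [x] and in the star of [to_sphere x]: pass through it at time 1/2. *)
Lemma bary_to_sphere_homotopic : homotopic_in R (realization R K) (realization R K)
  (bary \o to_sphere) id.
Proof.
(* Two segments run one after the other, written as one formula: the weights are piecewise linear in
   time, so continuity needs no gluing at 1/2. *)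
exists (fun p => pos (1 - 2 * p.2) *: bary (to_sphere p.1)
   + (1 - pos (1 - 2 * p.2) - pos (2 * p.2 - 1)) *: shave p.1 + pos (2 * p.2 - 1) *: p.1).
split; [|split].
- apply: continuous_in_subspaceT => -[x t]; rewrite inE => -[/= Kx t01].
  have c1 : cts_at (x, t) (@fst 'rV[R]_m R) by exact: cvg_fst.
  have c2 : cts_at (x, t) (@snd 'rV[R]_m R) by exact: cvg_snd.
  have c1i i : cts_at (x, t) (fun p : 'rV[R]_m * R => p.1 ord0 i) by exact: cont_coord.
  have c2t : cts_at (x, t) (fun p : 'rV[R]_m * R => 2 * p.2).
    by apply: cont_mul => //; exact: cont_cst.
  have ca : cts_at (x, t) (fun p : 'rV[R]_m * R => pos (1 - 2 * p.2)).
    by apply: cont_pos; apply: cont_sub => //; exact: cont_cst.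
  have cc : cts_at (x, t) (fun p : 'rV[R]_m * R => pos (2 * p.2 - 1)).
    by apply: cont_pos; apply: cont_sub => //; exact: cont_cst.
  apply: cont_row => i; apply: cts_at_eq => [z|]; first by rewrite mxE.
  apply: cont_add; last exact: scal_cont.
  apply: cts_at_eq => [z|]; first by rewrite mxE.
  apply: cont_add; apply: scal_cont => //.
  + by apply: bary_cont; [exact/sphere_neq0/sphere_to_sphere | exact: to_sphere_cont].
  + by apply: cont_sub => //; apply: cont_sub => //; exact: cont_cst.
  + exact: shave_cont.
- move=> _ [[x t] [/= Kx]] /[!in_itv]/= /andP[t0 t1] <-.
  have [S SK xS] := Kx; have y0 := sphere_neq0 (sphere_to_sphere Kx).
  have [th|th] := leP t (2^-1).
  + rewrite (pos_id (a := 1 - 2 * t)) ?(pos_eq0 (a := 2 * t - 1)); try lra.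
    rewrite scale0r addr0 subr0; exists (star (to_sphere x)); first exact: starK.
    have -> : 1 - (1 - 2 * t) = 2 * t by ring.
    apply: face_convex; [by apply/andP; split; lra | exact: face_bary |].
    apply: face_shave xS _ => i xi; rewrite inE; apply: to_sphere_rho => //; exact: ltW.
  + rewrite (pos_eq0 (a := 1 - 2 * t)) ?(pos_id (a := 2 * t - 1)); try lra.
    rewrite scale0r add0r subr0; exists S => //.
    apply: face_convex; [by apply/andP; split; lra | | by []].
    have [_ [xS0 _]] := xS; apply: (face_shave xS) => i xi.
    apply: contraLR xi => iS; rewrite xS0 // -leNgt invr_ge0 ler0n //.
- move=> x _ /=; split.
  + rewrite mulr0 subr0 sub0r (pos_id (a := 1)) ?ler01 // (pos_eq0 (a := -1)) ?lerN10 //.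
    by rewrite subr0 subrr !scale0r !addr0 scale1r.
  + have -> : 1 - 2 * 1 = -1 :> R by ring.
    have -> : 2 * 1 - 1 = 1 :> R by ring.
    rewrite (pos_id (a := 1)) ?ler01 // (pos_eq0 (a := -1)) ?lerN10 // subr0 subrr.
    by rewrite !scale0r !add0r scale1r.
Qed.

(** A large coordinate [i] of [bary u] puts both [u] and [to_sphere (bary u)] in the i-th cone. The
    segment between them stays in this convex cone, hence avoids the origin and can be
    normalised. *)
Lemma to_sphere_bary_homotopic : homotopic_in R (sphere R n) (sphere R n)
  (to_sphere \o bary) id.
Proof.
have seg u t : sphere R n u -> 0 <= t <= 1 -> (1 - t) *: to_sphere (bary u) + t *: u != 0.
  move=> /sphere_neq0 u0 /andP[t0 t1].
  have [i ui] := face_large_coord (face_bary u0); apply: (@rho_neq0 i).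
  have fi : 0 < rho i (to_sphere (bary u)).
    by apply: to_sphere_rho; [exact: realization_bary | exact: ltW].
  have ri : 0 < rho i u by apply: bary_gt0 => //; apply: lt_trans ui; rewrite invr_gt0 ltr0Sn.
  have [->|tn0] := eqVneq t 0; first by rewrite subr0 scale1r scale0r addr0.
  have [->|tn1] := eqVneq t 1; first by rewrite subrr scale1r scale0r add0r.
  by apply: rhoD; apply: rhoZ => //; rewrite ?subr_gt0 lt_neqAle ?tn1 // eq_sym tn0.
exists (fun p => sphere_proj ((1 - p.2) *: to_sphere (bary p.1) + p.2 *: p.1)).
split; [|split].
- apply: continuous_in_subspaceT => -[x t]; rewrite inE => -[/= Sx] /[!in_itv]/= t01.
  have c1 : cts_at (x, t) (@fst 'rV[R]_n R) by exact: cvg_fst.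
  have c2 : cts_at (x, t) (@snd 'rV[R]_n R) by exact: cvg_snd.
  have x0 := sphere_neq0 Sx.
  apply: (@cont_sphere_proj _ _ (x, t) _
    (fun p : 'rV[R]_n * R => (1 - p.2) *: to_sphere (bary p.1) + p.2 *: p.1)) => [|i].
    exact: seg.
  apply: cts_at_eq => [z|]; first by rewrite mxE.
  apply: cont_add; apply: scal_cont => //.
  + by apply: cont_sub => //; exact: cont_cst.
  + apply: to_sphere_cont => [|j]; first exact: realization_bary.
    by apply: cont_coord; exact: bary_cont.
- move=> _ [[x t] [/= Sx]] /[!in_itv]/= t01 <-.
  by apply: sphere_sphere_proj; exact: seg.
- move=> u Su; have u0 := sphere_neq0 Su; split => /=.
  + rewrite subr0 scale1r scale0r addr0 sphere_proj_id //.
    exact/sphere_to_sphere/realization_bary.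
  + by rewrite subrr scale1r scale0r add0r sphere_proj_id.
Qed.

Lemma cone_nerve : homotopy_equiv R (realization R K) (sphere R n).
Proof.
exists to_sphere, bary; do 5?split.
- apply: continuous_in_subspaceT => x; rewrite inE => Kx.
  by apply: (@to_sphere_cont _ x id) => // i; apply: cont_coord.
- by move=> _ [x Kx <-]; exact: sphere_to_sphere.
- apply: continuous_in_subspaceT => x; rewrite inE => Sx.
  by apply: (@bary_cont _ x id) => //; exact: sphere_neq0.
- by move=> _ [x Kx <-]; exact/realization_bary/sphere_neq0.
- exact: bary_to_sphere_homotopic.
- exact: to_sphere_bary_homotopic.
Qed.

End ConeNerve.

(** * Minimisation over faces and separation *)

Lemma compact_face (R : realType) m (S : {set 'I_m}) : compact (face S : set 'rV[R]_m).
Proof.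
pose B i := if i \in S then `[0, 1]%classic else [set (0 : R)].
have cB : compact [set x : 'rV[R]_m | forall i, B i (x ord0 i)].
  apply: rV_compact => i; rewrite /B; case: ifP => _; first exact: segment_compact.
  exact: compact_set1.
have cS : closed [set x : 'rV[R]_m | \sum_i x ord0 i = 1].
  apply: (@preimage_closed _ R (fun x : 'rV[R]_m => \sum_i x ord0 i) [set 1]).
    by move=> x _; apply: cont_sum => i; exact: coord_continuous.
  exact: closed_eq.
rewrite (_ : face S = [set x : 'rV[R]_m | forall i, B i (x ord0 i)] `&`
  [set x | \sum_i x ord0 i = 1]); first exact: compact_closedI.
apply/seteqP; split => x.
- move=> [x0 [xS x1]]; split => // i; rewrite /B; case: ifPn => [_|/xS //] /=.
  rewrite in_itv /= x0 -x1 (bigD1 i) //= lerDl; exact: sumr_ge0.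
- move=> [xB x1]; split; [|split] => // i.
  + by move: (xB i); rewrite /B; case: ifP => _ /=; [rewrite in_itv /= => /andP[] | move->].
  + by move: (xB i); rewrite /B => + /negbTE iS; rewrite iS.
Qed.

Lemma face_min (R : realType) m (S : {set 'I_m}) (f : 'rV[R]_m -> R) :
  continuous f -> (face S : set 'rV[R]_m) !=set0 -> exists2 p, face S p & forall x, face S x -> f p <= f x.
Proof.
move=> cf S0; have [|p /set_mem Sp pmin] := compact_EVT_min S0 (@compact_face R m S) (f := f).
  by apply: continuous_subspaceT.
by exists p => // x Sx; apply: pmin; exact/mem_set.
Qed.

Lemma cts_mulmx (R : realType) m n (A : 'M[R]_(m, n)) (x : 'rV[R]_m) j :
  cts_at x (fun y => (y *m A) ord0 j).
Proof.
apply: cts_at_eq => [y|]; first by rewrite mxE.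
by apply: cont_sum => i; apply: cont_mul; [exact: coord_continuous | exact: cont_cst].
Qed.

Lemma face_delta (R : realType) m (S : {set 'I_m}) i :
  i \in S -> face S (delta_mx ord0 i : 'rV[R]_m).
Proof.
move=> iS; split; [|split] => [j|j jS|].
- by rewrite mxE ler0n.
- by rewrite mxE eqxx /=; case: eqP jS => // ->; rewrite iS.
- rewrite (bigD1 i) //= mxE !eqxx big1 ?addr0 // => j /negbTE ji.
  by rewrite mxE eqxx ji.
Qed.

Lemma sqnorm_eq0 (R : realType) n (y : 'rV[R]_n) : (\sum_j y ord0 j ^+ 2 == 0) = (y == 0).
Proof.
apply/idP/eqP => [|->]; last by rewrite big1 // => j _; rewrite mxE expr0n.
by apply: contraTeq => /sqnorm_gt0; rewrite lt_neqAle eq_sym => /andP[].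
Qed.

(* The nearest point of [conv C] to the origin is a separating vector. *)
Lemma gordan (R : realType) m k (C : 'M[R]_(m, k)) (S : {set 'I_m}) :
  (forall x, face S x -> x *m C != 0) ->
  exists u : 'rV[R]_k, forall i, i \in S -> 0 < (C *m u^T) i ord0.
Proof.
move=> SC; have [->|/set0Pn[i0 i0S]] := eqVneq S finset.set0.
  by exists 0 => i; rewrite inE.
pose f (x : 'rV[R]_m) := \sum_j (x *m C) ord0 j ^+ 2.
have cf : continuous f.
  move=> x; apply: cont_sum => j; apply: cts_at_eq => [y|]; first by rewrite expr2.
  by apply: cont_mul; exact: cts_mulmx.
have [p Sp pmin] := face_min cf (ex_intro _ _ (face_delta R i0S)).
set y := p *m C; exists y => i iS.
have y0 : 0 < f p by apply: sqnorm_gt0; exact: SC.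
pose z := delta_mx ord0 i *m C - y.
pose a := \sum_j y ord0 j * z ord0 j; pose b := \sum_j z ord0 j ^+ 2.
have b0 : 0 <= b by apply: sumr_ge0 => j _; exact: sqr_ge0.
have fseg t : f ((1 - t) *: p + t *: delta_mx ord0 i) = f p + t * (2 * a) + t ^+ 2 * b.
  rewrite /a /b !mulr_sumr -!big_split /=; apply: eq_bigr => j _.
  rewrite mulmxDl -!scalemxAl -/y /z !mxE; ring.
have {pmin} fmin t : 0 <= t <= 1 -> 0 <= t * (2 * a) + t ^+ 2 * b.
  move=> t01; have := pmin _ (face_convex t01 Sp (face_delta R iS)).
  by rewrite fseg -addrA lerDl.
have a0 : 0 <= a.
  rewrite leNgt; apply/negP => an.
  have d0 : 0 < b - a + 1 by lra.
  (* A substitute for the minimiser -a/b of the quadratic: the larger denominator stays positive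
     when b = 0 and keeps the value at most 1. The quadratic is negative there, against [fmin]. *)
  have t0 : 0 < - a / (b - a + 1) by rewrite divr_gt0 // oppr_gt0.
  have := fmin (- a / (b - a + 1)); rewrite ltW //= ler_pdivrMr //.
  rewrite expr2 -mulrA -mulrDr pmulr_rge0 //.
  have -> : 2 * a + - a / (b - a + 1) * b = (2 * a * (b - a + 1) - a * b) / (b - a + 1).
    by field; rewrite gt_eqF.
  rewrite pmulr_lge0 ?invr_gt0 //.
  have : 0 <= - a * b by rewrite mulr_ge0 // oppr_ge0 ltW.
  have : 0 < a * a by rewrite nmulr_rgt0.
  move=> ? ? h; have /h : - a <= 1 * (b - a + 1) by lra.
  lra.
(* The i-th row of [C] is y + z, and its inner product with y is |y|^2 + a. *)
have -> : (C *m y^T) i ord0 = f p + a.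
  rewrite /a -big_split /= mxE; apply: eq_bigr => j _.
  by rewrite /z -rowE !mxE -/y /=; ring.
lra.
Qed.

(** Encodes finitely many strict inequalities as positivity of a single continuous nonnegative
    function, as the cones of the dual cover require. *)
Lemma prod_pos_gt0 (R : realType) (I : finType) (F : I -> R) :
  0 < \prod_i Num.max 0 (F i) <-> forall i, 0 < F i.
Proof.
split=> [h i|h]; last by apply: prodr_gt0 => i _; rewrite pos_gt0.
rewrite -pos_gt0 lt_neqAle pos_ge0 andbT eq_sym.
by apply: contraTneq h => Fi; rewrite (bigD1 i) //= Fi mul0r ltxx.
Qed.

(** * Spheres from a positive linear dependence of rows *)

Section PositiveDependence.
Context {R : realType} {m d : nat} (M : 'M[R]_(m, d)) (w : 'rV[R]_m).
Hypothesis w_gt0 : forall i, 0 < w ord0 i.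
Hypothesis w_sum : \sum_i w ord0 i = 1.
Hypothesis wM : w *m M = 0.

Lemma face_w : face [set: 'I_m] w.
Proof. by split; [move=> i; exact: ltW | split=> // i; rewrite inE]. Qed.

Lemma unbalanced_sphere (K : {set {set 'I_m}}) :
  (forall S : {set 'I_m}, S \in K <-> forall x, face S x -> x *m M != 0) ->
  homotopy_equiv R (realization R K) (sphere R (\rank M)).
Proof.
(* Passing to [col_base M] keeps the left kernel and gives full column rank, so functionals on the
   row space become vectors of length [\rank M]. *)
move=> KP; pose C := col_base M.
have kerC (x : 'rV_m) : (x *m M == 0) = (x *m C == 0).
  by rewrite -{1}(mulmx_base M) mulmxA mulmx_free_eq0 // row_base_free.
pose h i (u : 'rV[R]_(\rank M)) := (C *m u^T) i ord0.
pose rho i u := Num.max 0 (h i u).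
have hD i u v : h i (u + v) = h i u + h i v by rewrite /h linearD mulmxDr [LHS]mxE.
have hZ i a u : h i (a *: u) = a * h i u by rewrite /h linearZ -scalemxAr [LHS]mxE.
have /choice [pt ptP] : forall S : {set 'I_m}, exists u,
    S \in K -> forall i, i \in S -> 0 < h i u.
  move=> S; have [SK|] := boolP (S \in K); last by exists 0.
  have [x Sx|u uS] := @gordan R m _ C S; first by rewrite -kerC; move: x Sx; apply/KP.
  by exists u.
apply: (@cone_nerve R m _ K rho _ _ _ _ _ _ _ pt).
- move=> i u; apply: cont_pos; apply: cts_at_eq => [y|]; first by rewrite /h mxE.
  apply: cont_sum => j; apply: cont_mul; first exact: cont_cst.
  by apply: cts_at_eq => [y|]; [by rewrite mxE | exact: coord_continuous].
- by move=> i u; exact: pos_ge0.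
- by move=> i; rewrite /rho /h trmx0 mulmx0 mxE maxxx.
- move=> i u v; rewrite !pos_gt0 hD; exact: addr_gt0.
- by move=> i a u a0; rewrite !pos_gt0 hZ => ?; rewrite mulr_gt0.
(* Covering: if no [h i u] is positive, their sum with the positive weights [w] is zero, so each one
   vanishes; full column rank then gives u = 0. *)
- move=> u; apply: contra_neqP => /forallNP hu.
  have hle i : h i u <= 0 by rewrite leNgt -pos_gt0; apply/negP; exact: hu.
  have : \sum_i w ord0 i * - h i u = 0.
    under eq_bigr do rewrite mulrN.
    rewrite sumrN; apply/eqP; rewrite oppr_eq0; apply/eqP.
    transitivity ((w *m (C *m u^T)) ord0 ord0); first by rewrite mxE.
    by rewrite mulmxA (eqP (_ : w *m C == 0)) ?mul0mx ?mxE // -kerC wM eqxx.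
  move/psumr_eq0P => h0; have Cu : C *m u^T = 0.
    apply/matrixP => i j; rewrite ord1 [RHS]mxE; apply/eqP.
    have /eqP := h0 (fun i _ => mulr_ge0 (ltW (w_gt0 i)) (etrans (oppr_ge0 _) (hle i))) i isT.
    by rewrite mulf_eq0 gt_eqF //= oppr_eq0.
  have /row_fullP [B BC] := col_base_full M.
  by apply: trmx_inj; rewrite trmx0 -[LHS]mul1mx -BC -mulmxA Cu mulmx0.
(* The easy half of Gordan: a relation [x] on [S] would make the sum of the x_i h_i(u) zero, while
   its terms are nonnegative and one is positive. *)
- move=> S u uS; apply/KP => x [x0 [xS x1]]; rewrite kerC; apply/negP => /eqP xC.
  have : \sum_i x ord0 i * h i u = 0.
    transitivity ((x *m (C *m u^T)) ord0 ord0); first by rewrite mxE.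
    by rewrite mulmxA xC mul0mx mxE.
  have xh i : 0 <= x ord0 i * h i u.
    have [iS|iS] := boolP (i \in S); last by rewrite xS // mul0r.
    by rewrite mulr_ge0 // ltW // -pos_gt0; exact: uS.
  have [i xi] := @face_large_coord R m S x (conj x0 (conj xS x1)).
  have {}xi : 0 < x ord0 i by apply: lt_trans xi; rewrite invr_gt0 ltr0Sn.
  have iS : i \in S by apply: contraLR xi => iS; rewrite xS // ltxx.
  move/eqP; rewrite gt_eqF //; apply: (@sum_pos _ _ _ i) => //.
  by rewrite mulr_gt0 // -pos_gt0; exact: uS.
- by move=> S i SK iS; rewrite pos_gt0; exact: ptP.
Qed.

(* [e] is the size of the thickening in the dual cover. *)
Lemma face_gap : exists2 e : R, 0 < e < 1 & forall S : {set 'I_m},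
  (exists x, [/\ face [set: 'I_m] x, x *m M = 0 & \sum_(i in S) x ord0 i < e]) ->
  exists2 x : 'rV[R]_m, face (~: S) x & x *m M = 0.
Proof.
have /choice [e eP] : forall S : {set 'I_m}, exists e : R, 0 < e /\
  ((exists x, [/\ face [set: 'I_m] x, x *m M = 0 & \sum_(i in S) x ord0 i < e]) ->
  exists2 x : 'rV[R]_m, face (~: S) x & x *m M = 0).
  move=> S; have [good|bad] := pselect (exists2 x : 'rV[R]_m, face (~: S) x & x *m M = 0).
    by exists 1.
  (* On the simplex this function vanishes exactly at the relations supported off [S]. If there are
     none, its minimum is positive and serves as the bound for [S]. *)
  pose f (x : 'rV[R]_m) := \sum_(i in S) x ord0 i + \sum_j (x *m M) ord0 j ^+ 2.
  have cf : continuous f.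
    move=> x; apply: cont_add; apply: cont_sum => j; first exact: coord_continuous.
    apply: cts_at_eq => [y|]; first by rewrite expr2.
    by apply: cont_mul; exact: cts_mulmx.
  have [p [p0 [_ p1]] pmin] := face_min cf (ex_intro _ _ face_w).
  have s0 : 0 <= \sum_(i in S) p ord0 i by exact: sumr_ge0.
  have q0 : 0 <= \sum_j (p *m M) ord0 j ^+ 2 by apply: sumr_ge0 => j _; exact: sqr_ge0.
  exists (f p); split.
    rewrite lt_neqAle addr_ge0 // andbT eq_sym paddr_eq0 //; apply/negP => /andP[/eqP sS].
    rewrite sqnorm_eq0 => /eqP pM; apply: bad; exists p => //; split; [|split] => // i.
    rewrite inE negbK => iS.
    by move/psumr_eq0P : sS => /(_ (fun j _ => p0 j) i iS).
  move=> [x [Sx xM xe]]; exfalso; have := pmin x Sx.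
  rewrite [f x]/f xM (_ : \sum_j _ = 0) ?addr0; last by apply/eqP; rewrite sqnorm_eq0.
  by rewrite leNgt xe.
have sum0 : 0 <= \sum_S (e S)^-1 by apply: sumr_ge0 => S _; rewrite invr_ge0 ltW //; case: (eP S).
(* The sum of inverses dominates each [(e S)^-1], which puts this value below every [e S]; the
   summand 2 puts it below 1. *)
exists (2 + \sum_S (e S)^-1)^-1.
  by rewrite invr_gt0 invf_lt1; lra.
move=> S [x [Sx xM xe]]; have [eS] := eP S; apply; exists x; split => //.
apply: (lt_le_trans xe); rewrite -[leRHS]invrK lef_pV2 ?posrE ?invr_gt0 //; last lra.
rewrite (bigD1 S) //=; have : 0 <= \sum_(T | T != S) (e T)^-1.
  by apply: sumr_ge0 => T _; rewrite invr_ge0 ltW //; case: (eP T).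
lra.
Qed.

(** The kernel consists of the relations with coefficient sum zero, the directions of the weight
    polytope. The all-ones column is independent of the columns of [M], because [w] annihilates [M]
    but has sum 1. *)
Lemma rank_affine_ker :
  \rank (kermx (row_mx M (const_mx 1 : 'cV[R]_m))) = (m - \rank M - 1)%N.
Proof.
rewrite mxrank_ker -subnDA; congr (m - _)%N.
rewrite -mxrank_tr tr_row_mx -addsmxE mxrank_disjoint_sum.
  rewrite mxrank_tr rank_rV; congr (_ + _)%N.
  case: eqP => // /matrixP h; case: (pickP 'I_m) => [i _|m0].
    by have := h ord0 i; rewrite !mxE => /eqP; rewrite oner_eq0.
  by move: w_sum; rewrite big1 => [/eqP|i]; [rewrite eq_sym oner_eq0 | move: (m0 i)].
apply/eqP/rowV0P => z; rewrite sub_capmx => /andP[/submxP[y zy] /sub_rVP[a za]].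
have : z *m w^T = 0 by rewrite zy -mulmxA -trmx_mul wM trmx0 mulmx0.
rewrite za -scalemxAl => /matrixP /(_ ord0 ord0); rewrite !mxE.
under eq_bigr do rewrite !mxE mul1r.
by rewrite w_sum mulr1 => ->; rewrite scale0r.
Qed.

Lemma dual_sphere (K : {set {set 'I_m}}) :
  (forall S : {set 'I_m}, S \in K <-> exists2 x : 'rV[R]_m, face (~: S) x & x *m M = 0) ->
  homotopy_equiv R (realization R K) (sphere R (m - \rank M - 1)%N).
Proof.
move=> KP; rewrite -rank_affine_ker; set A := row_mx _ _.
pose N := row_base (kermx A).
have NA (u : 'rV_(\rank (kermx A))) : u *m N *m A = 0.
  by apply/sub_kermxP; rewrite (submx_trans (submxMl _ _)) // eq_row_base.
have NM (u : 'rV_(\rank (kermx A))) : u *m N *m M = 0.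
  by have /eqP := NA u; rewrite mul_mx_row row_mx_eq0 => /andP[/eqP].
have N1 (u : 'rV_(\rank (kermx A))) : \sum_i (u *m N) ord0 i = 0.
  have /eqP := NA u; rewrite mul_mx_row row_mx_eq0 => /andP[_ /eqP/matrixP/(_ ord0 ord0)].
  rewrite !mxE => H; rewrite -[RHS]H; apply: eq_bigr => i _.
  by rewrite [const_mx _ _ _]mxE mulr1.
have kerN (x : 'rV_m) : x *m M = 0 -> \sum_i x ord0 i = 0 -> exists u, x = u *m N.
  move=> xM x1; apply/submxP; rewrite eq_row_base; apply/sub_kermxP.
  rewrite mul_mx_row xM (_ : x *m const_mx 1 = 0) ?row_mx0 //.
  by apply/matrixP => i j; rewrite !ord1 !mxE -[RHS]x1; apply: eq_bigr => l _; rewrite !mxE mulr1.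
have [e /andP[e0 e1] gap] := face_gap.
(* Moving from [w] along [- u *m N], a coordinate with [h u i > 0] reaches zero at time 1/h, so the
   facets met first have maximal [h u i]. Positivity of [rho i u] asks for a nearly maximal value;
   its factor j = i forces [h u i > 0]. *)
pose h (u : 'rV_(\rank (kermx A))) i := (u *m N) ord0 i / w ord0 i.
pose rho i u := \prod_j Num.max 0 (h u i - (1 - e) * h u j).
have hD u v i : h (u + v) i = h u i + h v i by rewrite /h mulmxDl mxE mulrDl.
have hZ a u i : h (a *: u) i = a * h u i by rewrite /h -scalemxAl mxE mulrA.
have rhoP i u : 0 < rho i u <-> forall j, (1 - e) * h u j < h u i.
  by rewrite /rho prod_pos_gt0; split => H j; have := H j; rewrite subr_gt0.
have /choice [pt ptP] : forall S : {set 'I_m}, exists u,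
    S \in K -> forall i, i \in S -> 0 < rho i u.
  move=> S; have [SK|] := boolP (S \in K); last by exists 0.
  have /KP [x [x0 [xS x1]] xM] := SK.
  (* The direction w - x points away from a point [x] of the polytope vanishing on [S]: its ratios
     [h] equal 1 on [S] and are at most 1 elsewhere. *)
  have [||u xu] := kerN (w - x).
  + by rewrite mulmxBl wM xM subr0.
  + under eq_bigr do rewrite !mxE.
    by rewrite big_split /= sumrN w_sum x1 subrr.
  exists u => _ i iS; apply/rhoP => j.
  have -> : h u i = 1 by rewrite /h -xu !mxE xS ?inE ?iS // subr0 divff // gt_eqF.
  have hj : h u j <= 1 by rewrite /h -xu !mxE ler_pdivrMr // mul1r gerBl.
  apply: (@le_lt_trans _ _ ((1 - e) * 1)); last lra.
  by rewrite ler_wpM2l //; lra.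
have hmax (u : 'rV_(\rank (kermx A))) : u != 0 -> exists i, 0 < h u i /\ forall j, h u j <= h u i.
  move=> u0; have x0 : u *m N != 0 by rewrite mulmx_free_eq0 // row_base_free.
  have [i0 _] : exists i, (u *m N) ord0 i != 0.
    apply: contrapT => /forallNP H; move/eqP: x0; apply; apply/rowP => i.
    by rewrite [RHS]mxE; apply/eqP/negPn/negP/H.
  pose i := [arg max_(i > i0) h u i]%O.
  have hi j : h u j <= h u i by rewrite /i; case: arg_maxP => // k _; apply.
  (* A direction has coordinate sum zero, so a nonpositive maximum would force all its coordinates
     to vanish. *)
  exists i; split => //; rewrite ltNge; apply/negP => hi0.
  have le0 j : 0 <= - (u *m N) ord0 j.
    rewrite oppr_ge0; have := le_trans (hi j) hi0.
    by rewrite /h pmulr_lle0 // invr_gt0.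
  have : \sum_j - (u *m N) ord0 j = 0 by rewrite sumrN N1 oppr0.
  move/psumr_eq0P => /(_ (fun j _ => le0 j)) H; move/eqP: x0; apply.
  by apply/rowP => j; rewrite [RHS]mxE; apply/eqP; rewrite -oppr_eq0 H.
apply: (@cone_nerve R m _ K rho _ _ _ _ _ _ _ pt).
- move=> i u; apply: cont_prod => j; apply: cont_pos; apply: cont_sub.
    by apply: cont_mul; [exact: cts_mulmx | exact: cont_cst].
  apply: cont_mul; first exact: cont_cst.
  by apply: cont_mul; [exact: cts_mulmx | exact: cont_cst].
- by move=> i u; apply: prodr_ge0 => j _; exact: pos_ge0.
- move=> i; rewrite /rho (bigD1 i) //= /h mul0mx mxE !mul0r mulr0 subr0 maxxx mul0r //.
- move=> i u v /rhoP hu /rhoP hv; apply/rhoP => j; rewrite !hD mulrDr; exact: ltrD.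
- move=> i a u a0 /rhoP hu; apply/rhoP => j; rewrite !hZ mulrCA ltr_pM2l //.
- move=> u /hmax [i [hi him]]; exists i; apply/rhoP => j.
  apply: (@le_lt_trans _ _ ((1 - e) * h u i)); first by rewrite ler_wpM2l //; lra.
  by rewrite gtr_pMl //; lra.
- move=> S u uS; apply/KP; apply: gap.
  have [S0|/set0Pn[i0 i0S]] := eqVneq S finset.set0.
    by exists w; split; [exact: face_w | exact: wM | rewrite S0 big_set0].
  have u0 : u != 0.
    have /rhoP /(_ i0) := uS _ i0S; apply: contraTneq => ->.
    by rewrite /h mul0mx mxE mul0r mulr0 ltxx.
  have [l [hl hlm]] := hmax u u0.
  have ent i : (w - (h u l)^-1 *: (u *m N)) ord0 i = w ord0 i - (h u l)^-1 * (u *m N) ord0 i.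
    by rewrite mxE [X in _ + X]mxE [X in _ - X]mxE.
  (* The point where the ray from [w] leaves the polytope. Near maximality of [h] on [S] makes its
     coordinates there less than e w_i, so they sum to less than [e] and [gap] applies. *)
  exists (w - (h u l)^-1 *: (u *m N)); split.
  + split; [|split] => [i|i|]; rewrite ?inE //.
      rewrite ent subr_ge0 mulrC ler_pdivrMr // mulrC -ler_pdivrMr //.
      exact: hlm.
    under eq_bigr do rewrite ent.
    by rewrite big_split /= sumrN -mulr_sumr N1 mulr0 subr0.
  + by rewrite mulmxBl wM -scalemxAl NM scaler0 subr0.
  + have lt1 i : i \in S -> (w - (h u l)^-1 *: (u *m N)) ord0 i < e * w ord0 i.
      move=> iS; have /rhoP /(_ l) := uS _ iS; rewrite {2}/h ltr_pdivlMr // => H.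
      rewrite ent ltrBlDr -ltrBlDl; rewrite [ltRHS]mulrC ltr_pdivlMr //.
      apply: le_lt_trans H; rewrite le_eqVlt; apply/orP; left; apply/eqP; ring.
    apply: (@lt_le_trans _ _ (\sum_(i in S) e * w ord0 i)).
      by apply: ltr_sum => //; apply/hasP; exists i0 => //; rewrite mem_index_enum.
    rewrite -mulr_sumr -[leRHS]mulr1; apply: ler_wpM2l; first exact: ltW.
    rewrite -w_sum [leRHS](bigID (mem S)) /=.
    by rewrite lerDl; apply: sumr_ge0 => i _; exact: ltW.
- by move=> S i SK iS; exact: ptP.
Qed.

End PositiveDependence.

(** * Point configurations translated to have [r] at the origin *)

Section RelativeInterior.
Context {R : realType} {d m : nat} (v : 'I_m -> 'rV[R]_d) (r : 'rV[R]_d).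

Let M : 'M[R]_(m, d) := \matrix_i (v i - r).

Lemma mulmx_shift (x : 'rV[R]_m) :
  \sum_i x ord0 i = 1 -> x *m M = \sum_i x ord0 i *: v i - r.
Proof.
move=> x1; rewrite mulmx_sum_row -[r in RHS]scale1r -x1 scaler_suml -sumrB.
by apply: eq_bigr => i _; rewrite rowK scalerBr.
Qed.

Lemma conv_subP (S : {set 'I_m}) :
  conv_sub v S r <-> exists2 x : 'rV[R]_m, face S x & x *m M = 0.
Proof.
split=> [[w [w0 [wS [w1 rE]]]]|[x [x0 [xS x1]] xM]].
  have w1' : \sum_i (\row_i w i) ord0 i = 1 by under eq_bigr do rewrite mxE.
  exists (\row_i w i).
    split; [|split] => // [i|i iS]; rewrite mxE //; exact: wS.
  rewrite mulmx_shift // rE; apply/eqP; rewrite subr_eq0; apply/eqP.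
  by apply: eq_bigr => i _; rewrite mxE.
exists (x ord0); split => //; split => //; split => //.
by apply/esym/eqP; rewrite -subr_eq0 -mulmx_shift // xM.
Qed.

(** Differences v_i - v_j are differences of rows of [M]; conversely, since w M = 0, the row v_i - r
    is the combination of the v_i - v_j with weights w_j. *)
Lemma aff_dimE (w : 'rV[R]_m) : \sum_i w ord0 i = 1 -> w *m M = 0 -> aff_dim v = \rank M.
Proof.
move=> w1 wM; apply/eqmx_rank/andP; split.
  apply/sumsmx_subP => i _; apply/sumsmx_subP => j _; rewrite genmxE.
  have -> : v i - v j = row i M - row j M by rewrite !rowK opprB addrA subrK.
  by rewrite addmx_sub ?eqmx_opp ?row_sub.
apply/row_subP => i.
have -> : row i M = \sum_j w ord0 j *: (v i - v j).
  have -> : row i M = row i M - w *m M by rewrite wM subr0.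
  rewrite mulmx_sum_row rowK -[X in X - _]scale1r -w1 scaler_suml -sumrB.
  by apply: eq_bigr => j _; rewrite rowK -scalerBr opprB addrA subrK.
apply: summx_sub => j _; apply: scalemx_sub.
by rewrite (sumsmx_sup i) // (sumsmx_sup j) // genmxE.
Qed.

(* Push [r] slightly away from the barycenter [b]: [r + t (r - b)] still lies in the hull. *)
Lemma relint_weights : relint_in (aff_hull v) (conv_sub v [set: 'I_m]%SET) r ->
  exists w : 'rV[R]_m, [/\ forall i, 0 < w ord0 i, \sum_i w ord0 i = 1 & w *m M = 0].
Proof.
move=> [[w0 [w0_ge0 [_ [w0_sum rE]]]] [e [e0 eP]]].
have m0 : (0 < m)%N.
  case: (posnP m) w0_sum => // m0; rewrite big1 => [/eqP|i]; first by rewrite eq_sym oner_eq0.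
  by have := ltn_ord i; rewrite {2}m0.
have mR : 0 < m%:R :> R by rewrite ltr0n.
have c1 : \sum_(i < m) m%:R^-1 = 1 :> R.
  by rewrite sumr_const card_ord -[LHS]mulr_natl divff // gt_eqF.
pose b := \sum_i m%:R^-1 *: v i.
pose t := e / (`|r - b| + 1).
have n0 : 0 < `|r - b| + 1 by rewrite ltr_wpDl.
have t0 : 0 < t by rewrite divr_gt0.
have [||w [w_ge0 [_ [w_sum wE]]]] := eP (r + t *: (r - b)) _ _.
- exists (fun i => w0 i + t * (w0 i - m%:R^-1)); split.
    by rewrite big_split /= -mulr_sumr sumrB w0_sum c1 subrr mulr0 addr0.
  rewrite {1 2}rE /b -sumrB scaler_sumr -big_split /=; apply: eq_bigr => i _.
  by rewrite scalerDl -scalerA scalerBl.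
- rewrite addrC addKr normrZ gtr0_norm // /t -mulrA gtr_pMr // mulrC ltr_pdivrMr //.
  by rewrite mul1r ltrDl.
have t1 : 0 < 1 + t by lra.
(* Solving r + t (r - b) = sum w_i v_i for [r] gives these weights; the share t/m of the barycentre
   makes each of them positive. *)
exists (\row_i ((w i + t * m%:R^-1) / (1 + t))).
have ws : \sum_i (\row_i ((w i + t * m%:R^-1) / (1 + t))) ord0 i = 1.
  under eq_bigr do rewrite mxE.
  by rewrite -mulr_suml big_split /= -mulr_sumr w_sum c1 mulr1 divff // gt_eqF.
split=> // [i|].
  by rewrite mxE divr_gt0 // ltr_wpDl // mulr_gt0 // invr_gt0.
rewrite mulmx_shift //; apply/eqP; rewrite subr_eq0; apply/eqP.
under eq_bigr do rewrite mxE mulrC -scalerA scalerDl -scalerA.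
rewrite -scaler_sumr big_split /= -wE -scaler_sumr -/b -addrA -scalerDr subrK.
have -> : r + t *: r = (1 + t) *: r by rewrite scalerDl scale1r.
by rewrite scalerA mulVf ?scale1r // gt_eqF.
Qed.

End RelativeInterior.

Theorem theorem3 (R : realType) (d m : nat) (v : 'I_m -> 'rV[R]_d)
  (r : 'rV[R]_d) :
  injective v ->
  relint_in (aff_hull v) (conv_sub v [set: 'I_m]%SET) r ->
  homotopy_equiv R (realization R (unbalanced v r)) (sphere R (aff_dim v)) /\
  homotopy_equiv R (realization R (alex_dual (unbalanced v r)))
    (sphere R (m - aff_dim v - 1)%N).
Proof.
move=> _ /relint_weights [w [w0 w1 wM]].
(* Both claims now concern relations among the rows v_i - r: [S] is unbalanced when no relation lies
   on [face S], and is in the dual when one lies on [face (~: S)]. *)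
rewrite (aff_dimE w1 wM); split.
  apply: (unbalanced_sphere w0 wM) => S; rewrite inE; split.
    by move=> /asboolP nS x Sx; apply/eqP => xM; apply/nS/conv_subP; exists x.
  by move=> H; apply/asboolP => /conv_subP [x Sx /eqP]; apply/negP; exact: H.
apply: (dual_sphere w0 w1 wM) => S; rewrite !inE; split.
  by move=> /asboolPn/contrapT /conv_subP.
by move=> H; apply/negP => /asboolP; apply; apply/conv_subP.
Qed.
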